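(* Let $H$ be a finite group, let $G_1$ and $G_2$ be finitely generated operator norm stable groups, and let $i_j\colon H\to G_j$ $(j=1,2)$ be injective homomorphisms. Then the amalgamated free product $G_1*_HG_2$ is operator norm stable.
   Context: For a finite-dimensional Hilbert space $X$ let $\mathrm{Aut}(X)$ be its unitary group with the metric $d(A_1,A_2)=\|A_1-A_2\|_{op}$ (operator norm). A group $G$ is operator norm stable if for any sequence of maps $\varphi_n\colon G\to \mathrm{Aut}(X_n)$, with $X_n$ finite-dimensional Hilbert spaces, satisfying $d(\varphi_n(g)\varphi_n(h),\varphi_n(gh))\to 0$ as $n\to\infty$ for all $g,h\in G$, there is a sequence of homomorphisms $\psi_n\colon G\to\mathrm{Aut}(X_n)$ such that $d(\varphi_n(g),\psi_n(g))\to 0$ for all $g\in G$. Given injective homomorphisms $i_j\colon H\to G_j$, $j=1,2$, the amalgamated free product is $G_1*_HG_2:=(G_1*G_2)/\langle\langle i_1(h)i_2(h)^{-1}: h\in H\rangle\rangle$. *)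

(* Defs.v *)
From HB Require Import structures.
From mathcomp Require Import all_boot all_order all_algebra.
From mathcomp Require Import sesquilinear complex.
From mathcomp Require Import all_classical all_reals all_analysis.
Set Implicit Arguments.
Unset Strict Implicit.
Unset Printing Implicit Defensive.
Import Order.TTheory GRing.Theory Num.Theory numFieldNormedType.Exports.

Local Open Scope classical_set_scope.
Local Open Scope quotient_scope.

Section Subgroups.
Local Open Scope group_scope.
Variable G : groupType.
Implicit Types (A N S : set G).

Definition subgroup A : Prop := A 1 /\ forall x y, A x -> A y -> A (x / y).

Definition normal_subgroup N : Prop :=
  subgroup N /\ forall x g, N x -> N (x ^ g).

Definition normal_closure S : set G := smallest normal_subgroup S.

Definition finitely_generated : Prop :=
  exists s : seq G, smallest subgroup [set` s] = [set: G].

Lemma normal_closureP S : normal_subgroup (normal_closure S).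
Proof.
split; first split.
- by move=> N [[[]]].
- move=> x y Sx Sy N NS; have [[[_ ND] _] _] := NS.
  by apply: ND; [exact: Sx | exact: Sy].
- by move=> x g Sx N NS; have [[_ NJ] _] := NS; apply: NJ; exact: Sx.
Qed.

End Subgroups.

Section QuotientByRelators.
Local Open Scope group_scope.
Variables (G : groupType) (S : set G).

Local Notation N := (normal_closure S).

Let N1 : N 1. Proof. by have [[]] := normal_closureP S. Qed.
Let NF x y : N x -> N y -> N (x / y).
Proof. by have [[_ +] _] := normal_closureP S; apply. Qed.
Let NJ x g : N x -> N (x ^ g).
Proof. by have [_] := normal_closureP S; apply. Qed.
Let NV x : N x -> N x^-1.
Proof. by move=> Nx; rewrite -[x^-1]mul1g; exact: NF. Qed.
Let NM x y : N x -> N y -> N (x * y).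
Proof. by move=> Nx Ny; rewrite -[y]invgK; apply: NF => //; exact: NV. Qed.

Definition ncl_rel (x y : G) : bool := `[< N (x^-1 * y) >].

Lemma ncl_rel_refl : reflexive ncl_rel.
Proof. by move=> x; apply/asboolP; rewrite mulVg. Qed.

Lemma ncl_rel_sym : symmetric ncl_rel.
Proof.
by move=> x y; apply/asboolP/asboolP => /NV; rewrite invgM invgK.
Qed.

Lemma ncl_rel_trans : transitive ncl_rel.
Proof.
move=> y x z /asboolP xy /asboolP yz; apply/asboolP.
by have := NM xy yz; rewrite mulgA mulgK.
Qed.

Canonical ncl_equiv :=
  EquivRel ncl_rel ncl_rel_refl ncl_rel_sym ncl_rel_trans.

(* The group G / <<S>>, where <<S>> is the normal closure of S. *)
Definition ncl_quotient : Type := {eq_quot ncl_equiv}.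
HB.instance Definition _ := Choice.copy ncl_quotient {eq_quot ncl_equiv}.

Definition ncl_proj (x : G) : ncl_quotient := \pi_{eq_quot ncl_equiv} x.
Definition ncl_repr (a : ncl_quotient) : G := repr (a : {eq_quot ncl_equiv}).

Lemma nclE x y : N (x^-1 * y) -> ncl_proj x = ncl_proj y.
Proof. by move=> xy; apply/eqmodP/asboolP. Qed.

Lemma ncl_reprK a : ncl_proj (ncl_repr a) = a.
Proof. exact: (@reprK _ {eq_quot ncl_equiv}). Qed.

Lemma ncl_projK x : N (x^-1 * ncl_repr (ncl_proj x)).
Proof.
by apply/asboolP; have /esym/eqmodP := ncl_reprK (ncl_proj x).
Qed.

Definition ncl_one : ncl_quotient := ncl_proj 1.
Definition ncl_mul (a b : ncl_quotient) : ncl_quotient :=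
  ncl_proj (ncl_repr a * ncl_repr b).
Definition ncl_inv (a : ncl_quotient) : ncl_quotient :=
  ncl_proj (ncl_repr a)^-1.

Lemma ncl_projM x y : ncl_proj (x * y) = ncl_mul (ncl_proj x) (ncl_proj y).
Proof.
apply: nclE; set x' := ncl_repr _; set y' := ncl_repr _.
have -> : (x * y)^-1 * (x' * y') = (x^-1 * x') ^ y * (y^-1 * y').
  by rewrite /conjg invgM !mulgA mulgK.
by apply: NM; [apply: NJ|]; exact: ncl_projK.
Qed.

Lemma ncl_projV x : ncl_proj x^-1 = ncl_inv (ncl_proj x).
Proof.
apply: nclE; set x' := ncl_repr _.
have -> : x^-1^-1 * x'^-1 = ((x^-1 * x')^-1) ^ x^-1.
  by rewrite /conjg invgM !invgK !mulgA mulgK.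
by apply: NJ; apply: NV; exact: ncl_projK.
Qed.

Fact ncl_mulA : associative ncl_mul.
Proof.
move=> a b c; rewrite -[a]ncl_reprK -[b]ncl_reprK -[c]ncl_reprK.
by rewrite -!ncl_projM mulgA.
Qed.
Fact ncl_mul1 : left_id ncl_one ncl_mul.
Proof. by move=> a; rewrite -[a]ncl_reprK -ncl_projM mul1g. Qed.
Fact ncl_1mul : right_id ncl_one ncl_mul.
Proof. by move=> a; rewrite -[a]ncl_reprK -ncl_projM mulg1. Qed.
Fact ncl_mulV : left_inverse ncl_one ncl_inv ncl_mul.
Proof. by move=> a; rewrite -[a]ncl_reprK -ncl_projV -ncl_projM mulVg. Qed.
Fact ncl_Vmul : right_inverse ncl_one ncl_inv ncl_mul.
Proof. by move=> a; rewrite -[a]ncl_reprK -ncl_projV -ncl_projM mulgV. Qed.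

HB.instance Definition _ := isGroup.Build ncl_quotient
  ncl_mulA ncl_mul1 ncl_1mul ncl_mulV ncl_Vmul.

HB.instance Definition _ := isMultiplicative.Build G ncl_quotient
  ncl_proj ncl_projM.

End QuotientByRelators.

Section FreeProduct.
Local Open Scope group_scope.
Variables G1 G2 : groupType.

Local Notation word := (seq (G1 + G2)).

Inductive fp_eq : word -> word -> Prop :=
| fp_refl w : fp_eq w w
| fp_sym w w' : fp_eq w w' -> fp_eq w' w
| fp_trans w w' w'' : fp_eq w w' -> fp_eq w' w'' -> fp_eq w w''
| fp_one1 u v : fp_eq (u ++ inl 1 :: v) (u ++ v)
| fp_one2 u v : fp_eq (u ++ inr 1 :: v) (u ++ v)
| fp_mul1 u v x y : fp_eq (u ++ [:: inl x, inl y & v]) (u ++ inl (x * y) :: v)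
| fp_mul2 u v x y : fp_eq (u ++ [:: inr x, inr y & v]) (u ++ inr (x * y) :: v).

Lemma fp_catl s w w' : fp_eq w w' -> fp_eq (s ++ w) (s ++ w').
Proof.
elim=> {w w'}.
- by move=> w; exact: fp_refl.
- by move=> w w' _; exact: fp_sym.
- by move=> w w' w'' _ h _; exact: fp_trans h.
- by move=> u v; rewrite !catA; exact: fp_one1.
- by move=> u v; rewrite !catA; exact: fp_one2.
- by move=> u v x y; rewrite !catA; exact: fp_mul1.
- by move=> u v x y; rewrite !catA; exact: fp_mul2.
Qed.

Lemma fp_catr s w w' : fp_eq w w' -> fp_eq (w ++ s) (w' ++ s).
Proof.
elim=> {w w'}.
- by move=> w; exact: fp_refl.
- by move=> w w' _; exact: fp_sym.
- by move=> w w' w'' _ h _; exact: fp_trans h.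
- by move=> u v; rewrite -!catA; exact: fp_one1.
- by move=> u v; rewrite -!catA; exact: fp_one2.
- by move=> u v x y; rewrite -!catA; exact: fp_mul1.
- by move=> u v x y; rewrite -!catA; exact: fp_mul2.
Qed.

Definition fp_linv (a : G1 + G2) : G1 + G2 :=
  match a with inl x => inl x^-1 | inr y => inr y^-1 end.

Definition fp_winv (w : word) : word := rev (map fp_linv w).

Lemma fp_winv_cat u v : fp_winv (u ++ v) = fp_winv v ++ fp_winv u.
Proof. by rewrite /fp_winv map_cat rev_cat. Qed.

Lemma fp_winv_cons a v : fp_winv (a :: v) = fp_winv v ++ [:: fp_linv a].
Proof. by rewrite /fp_winv /= rev_cons cats1. Qed.

Lemma fp_winvK : involutive fp_winv.
Proof.
move=> w; rewrite /fp_winv map_rev revK -map_comp map_id_in // => -[x|y] _ /=;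
  by rewrite invgK.
Qed.

Lemma fp_winv_eq w w' : fp_eq w w' -> fp_eq (fp_winv w) (fp_winv w').
Proof.
elim=> {w w'}.
- by move=> w; exact: fp_refl.
- by move=> w w' _; exact: fp_sym.
- by move=> w w' w'' _ h _; exact: fp_trans h.
- move=> u v; rewrite !fp_winv_cat fp_winv_cons /= invg1 -catA; exact: fp_one1.
- move=> u v; rewrite !fp_winv_cat fp_winv_cons /= invg1 -catA; exact: fp_one2.
- move=> u v x y; rewrite !fp_winv_cat !fp_winv_cons /= invgM -!catA; exact: fp_mul1.
- move=> u v x y; rewrite !fp_winv_cat !fp_winv_cons /= invgM -!catA; exact: fp_mul2.
Qed.

Lemma fp_mulV w : fp_eq (fp_winv w ++ w) [::].
Proof.
elim: w => [|a w IHw]; first exact: fp_refl.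
apply: fp_trans IHw; rewrite fp_winv_cons -catA.
case: a => [x|y] /=.
- by apply: fp_trans (fp_mul1 _ _ _ _) _; rewrite mulVg; exact: fp_one1.
- by apply: fp_trans (fp_mul2 _ _ _ _) _; rewrite mulVg; exact: fp_one2.
Qed.

Definition fp_rel (w w' : {classic word}) : bool := `[< fp_eq w w' >].

Lemma fp_rel_refl : reflexive fp_rel.
Proof. by move=> w; apply/asboolP; exact: fp_refl. Qed.
Lemma fp_rel_sym : symmetric fp_rel.
Proof. by move=> w w'; apply/asboolP/asboolP; exact: fp_sym. Qed.
Lemma fp_rel_trans : transitive fp_rel.
Proof.
by move=> w' w w'' /asboolP h /asboolP h'; apply/asboolP; exact: fp_trans h'.
Qed.

Canonical fp_equiv := EquivRel fp_rel fp_rel_refl fp_rel_sym fp_rel_trans.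

(* G1 * G2, as words in the letters of G1 and G2 under concatenation, modulo  *)
(* the congruence generated by the multiplication tables of the factors.      *)
Definition free_product : Type := {eq_quot fp_equiv}.
HB.instance Definition _ := Choice.copy free_product {eq_quot fp_equiv}.

Definition fp_class (w : word) : free_product := \pi_{eq_quot fp_equiv} w.
Definition fp_repr (a : free_product) : word := repr (a : {eq_quot fp_equiv}).

Lemma fpE w w' : fp_eq w w' -> fp_class w = fp_class w'.
Proof. by move=> ww'; apply/eqmodP/asboolP. Qed.

Lemma fp_reprK a : fp_class (fp_repr a) = a.
Proof. exact: (@reprK _ {eq_quot fp_equiv}). Qed.

Lemma fp_classK w : fp_eq w (fp_repr (fp_class w)).
Proof. by apply/asboolP; have /esym/eqmodP := fp_reprK (fp_class w). Qed.

Definition fp_one : free_product := fp_class [::].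
Definition fp_mul (a b : free_product) : free_product :=
  fp_class (fp_repr a ++ fp_repr b).
Definition fp_inv (a : free_product) : free_product :=
  fp_class (fp_winv (fp_repr a)).

Lemma fp_class_cat w w' : fp_class (w ++ w') = fp_mul (fp_class w) (fp_class w').
Proof.
apply: fpE; apply: (@fp_trans _ (fp_repr (fp_class w) ++ w')).
  exact/fp_catr/fp_classK.
exact/fp_catl/fp_classK.
Qed.

Lemma fp_class_inv w : fp_class (fp_winv w) = fp_inv (fp_class w).
Proof. exact/fpE/fp_winv_eq/fp_classK. Qed.

Fact fp_mulA : associative fp_mul.
Proof.
move=> a b c; rewrite -[a]fp_reprK -[b]fp_reprK -[c]fp_reprK.
by rewrite -!fp_class_cat catA.
Qed.
Fact fp_mul1g : left_id fp_one fp_mul.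
Proof. by move=> a; rewrite -[a]fp_reprK -fp_class_cat. Qed.
Fact fp_mulg1 : right_id fp_one fp_mul.
Proof. by move=> a; rewrite -[a]fp_reprK -fp_class_cat cats0. Qed.
Fact fp_mulVg : left_inverse fp_one fp_inv fp_mul.
Proof.
move=> a; rewrite -[a]fp_reprK -fp_class_inv -fp_class_cat.
exact/fpE/fp_mulV.
Qed.
Fact fp_mulgV : right_inverse fp_one fp_inv fp_mul.
Proof.
move=> a; rewrite -[a]fp_reprK -fp_class_inv -fp_class_cat.
by apply: fpE; rewrite -{1}[fp_repr a]fp_winvK; exact: fp_mulV.
Qed.

HB.instance Definition _ := isGroup.Build free_product
  fp_mulA fp_mul1g fp_mulg1 fp_mulVg fp_mulgV.

Definition fp_inl (x : G1) : free_product := fp_class [:: inl x].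
Definition fp_inr (y : G2) : free_product := fp_class [:: inr y].

Fact fp_inlM : {morph fp_inl : x y / x * y}.
Proof.
move=> x y; rewrite -[RHS]/(fp_mul (fp_class _) (fp_class _)) -fp_class_cat.
exact/esym/fpE/(fp_mul1 [::]).
Qed.
Fact fp_inrM : {morph fp_inr : x y / x * y}.
Proof.
move=> x y; rewrite -[RHS]/(fp_mul (fp_class _) (fp_class _)) -fp_class_cat.
exact/esym/fpE/(fp_mul2 [::]).
Qed.
HB.instance Definition _ := isMultiplicative.Build G1 free_product fp_inl fp_inlM.
HB.instance Definition _ := isMultiplicative.Build G2 free_product fp_inr fp_inrM.

End FreeProduct.

Section Amalgam.
Local Open Scope group_scope.
Variables (H G1 G2 : groupType).
Variables (i1 : {multiplicative H -> G1}) (i2 : {multiplicative H -> G2}).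

Definition amalgam_relators : set (free_product G1 G2) :=
  [set fp_inl G2 (i1 h) * (fp_inr G1 (i2 h))^-1 | h in [set: H]].

Definition amalgam : groupType := ncl_quotient amalgam_relators.

End Amalgam.

(* Finite-dimensional complex Hilbert spaces; completeness is automatic.  The *)
(* inner product is linear in the first variable, and dimension 0 is allowed. *)
Record fdHilbertType (R : realType) := FdHilbertType {
  hsort :> vectType R[i];
  hdot : {dot hsort for @Num.conj R[i]}%R
}.

Section Unitary.
Local Open Scope ring_scope.
Variables (R : realType) (X : fdHilbertType R).

Definition hnorm (v : X) : R := Num.sqrt (complex.Re (hdot X v v)).

Definition opnorm (f : 'End(X)) : R :=
  sup [set hnorm (f v) | v in [set v : X | hnorm v <= 1]].

(* In finite dimension a linear isometry of X is bijective, i.e. unitary; the *)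
(* group structure below has composition as its product.                      *)
Definition unitary_pred (f : 'End(X)) : bool :=
  `[< isometry (hdot X) (hdot X) f >].

Record unitary := Unitary { unitary_val :> 'End(X); _ : unitary_pred unitary_val }.
HB.instance Definition _ := [isSub for unitary_val].
HB.instance Definition _ := [Choice of unitary by <:].

Lemma unitaryP (f : unitary) : isometry (hdot X) (hdot X) f.
Proof. by apply/asboolP; exact: (valP f). Qed.

Lemma unitary_lker (f : unitary) : lker f == 0%VS.
Proof.
apply/eqP/vspaceP => v; rewrite memv0 memv_ker; apply/eqP/eqP => [fv0|->].
  apply/eqP; rewrite -(dnorm_eq0 (hdot X)) -(unitaryP f) fv0.
  by rewrite linear0l.
by rewrite linear0.
Qed.

Fact unitary_one_subproof : unitary_pred \1%VF.
Proof. by apply/asboolP => u v; rewrite !id_lfunE. Qed.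
Definition unitary_one : unitary := Unitary unitary_one_subproof.

Fact unitary_mul_subproof (f g : unitary) : unitary_pred (f \o g)%VF.
Proof. by apply/asboolP => u v; rewrite !comp_lfunE !unitaryP. Qed.
Definition unitary_mul (f g : unitary) : unitary :=
  Unitary (unitary_mul_subproof f g).

Fact unitary_inv_subproof (f : unitary) : unitary_pred (f^-1)%VF.
Proof.
apply/asboolP => u v; rewrite -(unitaryP f) -!comp_lfunE.
by rewrite (lker0_compfV (unitary_lker f)) !id_lfunE.
Qed.
Definition unitary_inv (f : unitary) : unitary :=
  Unitary (unitary_inv_subproof f).

Fact unitary_mulA : associative unitary_mul.
Proof. by move=> f g h; apply: val_inj; rewrite /= comp_lfunA. Qed.
Fact unitary_mul1g : left_id unitary_one unitary_mul.
Proof. by move=> f; apply: val_inj; rewrite /= comp_lfun1l. Qed.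
Fact unitary_mulg1 : right_id unitary_one unitary_mul.
Proof. by move=> f; apply: val_inj; rewrite /= comp_lfun1r. Qed.
Fact unitary_mulVg : left_inverse unitary_one unitary_inv unitary_mul.
Proof.
by move=> f; apply: val_inj; rewrite /= lker0_compVf // unitary_lker.
Qed.
Fact unitary_mulgV : right_inverse unitary_one unitary_inv unitary_mul.
Proof.
by move=> f; apply: val_inj; rewrite /= lker0_compfV // unitary_lker.
Qed.

HB.instance Definition _ := isGroup.Build unitary
  unitary_mulA unitary_mul1g unitary_mulg1 unitary_mulVg unitary_mulgV.

Definition unitary_dist (f g : unitary) : R :=
  opnorm ((f : 'End(X)) - (g : 'End(X))).

End Unitary.

Definition op_norm_stable (R : realType) (G : groupType) : Prop :=
  forall (X : nat -> fdHilbertType R) (phi : forall n, G -> unitary (X n)),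
    (forall g h : G,
       unitary_dist (phi n g * phi n h)%g (phi n (g * h)%g)
         @[n --> \oo] --> (0 : R)%R) ->
    exists psi : forall n, {multiplicative G -> unitary (X n)},
      forall g : G, unitary_dist (phi n g) (psi n g) @[n --> \oo] --> (0 : R)%R.

(* Main.v *)
Require Import Defs.
From HB Require Import structures.
From mathcomp Require Import all_boot all_order all_fingroup all_algebra.
From mathcomp Require Import sesquilinear spectral complex lra.
From mathcomp Require Import all_classical all_reals all_analysis.

(* Restricting an asymptotic representation phi of G1 *_H G2 to the factors   *)
(* and using their stability gives homomorphisms psi1 and psi2 of G1 and G2   *)
(* whose restrictions r1 and r2 to H differ by                                *)
(*   eps = \sum_(h in H) d (r1 h) (r2 h) -> 0.                                *)
(* The average T of r1 h * (r2 h)^-1 over H intertwines r2 and r1, and        *)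
(* |T - 1| <= eps. If eps < 1, its unitary part W = T (T^* T)^(-1/2) still    *)
(* intertwines, and |W - 1| <= 2 eps. Conjugating psi2 by W makes it agree    *)
(* with psi1 on H, so both extend to a homomorphism of the amalgam. That      *)
(* homomorphism is close to phi on the two factors, hence, by asymptotic      *)
(* multiplicativity, on every product of their elements.                      *)

Set Implicit Arguments.
Unset Strict Implicit.
Unset Printing Implicit Defensive.
Import Order.TTheory GRing.Theory Num.Theory numFieldNormedType.Exports.

Local Open Scope classical_set_scope.
Local Open Scope ring_scope.

(** * Homomorphisms out of amalgamated free products *)

(** A homomorphism out of the amalgam is a pair of homomorphisms out of the factors that agree on
    $H$ ([amalgam_lift]). Stability of the factors produces such pairs with only approximate
    agreement, and this defect is the whole difficulty. Finiteness of $H$ repairs it: two unitary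
    representations of a finite group that are uniformly close are conjugate by a unitary close to 1
    ([unitary_intertwiner]). Averaging gives an intertwiner near 1, and polar decomposition makes it
    unitary without losing the intertwining property ([unitary_part], resting on the spectral
    theorem [selfadjoint_eigenbasis]). [amalgam_unitary_lift] turns this into a corrected
    representation with error linear in the defect, and [amalgam_ind] carries convergence from the
    factors to all elements. *)

Section GroupMorphisms.
Local Open Scope group_scope.
Variables (G H : groupType) (f : {multiplicative G -> H}).

Fact multiplicative1 : f 1 = 1.
Proof. by apply: (mulgI (f 1)); rewrite -gmulfM !mulg1. Qed.

Fact multiplicativeV : {morph f : x / x^-1}.
Proof.
by move=> x; apply: (mulgI (f x)); rewrite -gmulfM !mulgV multiplicative1.
Qed.

End GroupMorphisms.

Section FreeProductLift.
Local Open Scope group_scope.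
Variables (G1 G2 K : groupType).
Variables (a1 : {multiplicative G1 -> K}) (a2 : {multiplicative G2 -> K}).

Definition fp_eval (w : seq (G1 + G2)) : K :=
  foldr (fun l k => match l with inl x => a1 x | inr y => a2 y end * k) 1 w.

Lemma fp_eval_cat u v : fp_eval (u ++ v) = fp_eval u * fp_eval v.
Proof. by elim: u => [|l u IHu] /=; rewrite ?mul1g // IHu mulgA. Qed.

Lemma fp_eval_eq w w' : fp_eq w w' -> fp_eval w = fp_eval w'.
Proof.
elim=> // {w w'}.
- by move=> w w' w'' _ -> _ ->.
- by move=> u v; rewrite !fp_eval_cat /= multiplicative1 mul1g.
- by move=> u v; rewrite !fp_eval_cat /= multiplicative1 mul1g.
- by move=> u v x y; rewrite !fp_eval_cat /= gmulfM !mulgA.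
- by move=> u v x y; rewrite !fp_eval_cat /= gmulfM !mulgA.
Qed.

Definition fp_lift (a : free_product G1 G2) : K := fp_eval (fp_repr a).

Lemma fp_lift_class w : fp_lift (fp_class w) = fp_eval w.
Proof. exact/esym/fp_eval_eq/fp_classK. Qed.

Lemma fp_lift_inl x : fp_lift (fp_inl G2 x) = a1 x.
Proof. by rewrite fp_lift_class /= mulg1. Qed.

Lemma fp_lift_inr y : fp_lift (fp_inr G1 y) = a2 y.
Proof. by rewrite fp_lift_class /= mulg1. Qed.

Fact fp_liftM : {morph fp_lift : a b / a * b}.
Proof.
by move=> a b; rewrite -[a * b]/(fp_class (_ ++ _)) fp_lift_class fp_eval_cat.
Qed.
HB.instance Definition _ :=
  isMultiplicative.Build (free_product G1 G2) K fp_lift fp_liftM.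

End FreeProductLift.

Section QuotientLift.
Local Open Scope group_scope.
Variables (G K : groupType) (S : set G) (f : {multiplicative G -> K}).
Hypothesis fS : forall x, S x -> f x = 1.

Lemma ncl_ker x : normal_closure S x -> f x = 1.
Proof.
(* The kernel of [f] is one of the normal subgroups containing [S] whose intersection is the normal
   closure. *)
move=> Sx; apply: (Sx [set y | f y = 1]); split=> //; split; first split.
- exact: multiplicative1.
- by move=> y z /= fy fz; rewrite gmulfM multiplicativeV fy fz divgg.
- by move=> y z /= fy; rewrite !gmulfM fy multiplicativeV mul1g mulVg.
Qed.

Definition ncl_lift (a : ncl_quotient S) : K := f (ncl_repr a).

Lemma ncl_lift_proj x : ncl_lift (ncl_proj S x) = f x.
Proof.
have /ncl_ker := @ncl_projK _ S x; rewrite gmulfM multiplicativeV => fx.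
by apply: (mulgI (f x)^-1); rewrite mulVg.
Qed.

Fact ncl_liftM : {morph ncl_lift : a b / a * b}.
Proof. by move=> a b; rewrite -[a * b]/(ncl_proj S _) ncl_lift_proj gmulfM. Qed.

End QuotientLift.

Section AmalgamUniversal.
Local Open Scope group_scope.
Variables (H G1 G2 : groupType).
Variables (i1 : {multiplicative H -> G1}) (i2 : {multiplicative H -> G2}).

Definition amalgam_inl : G1 -> amalgam i1 i2 :=
  ncl_proj (amalgam_relators i1 i2) \o @fp_inl G1 G2.
Definition amalgam_inr : G2 -> amalgam i1 i2 :=
  ncl_proj (amalgam_relators i1 i2) \o @fp_inr G1 G2.
HB.instance Definition _ := Multiplicative.copy amalgam_inl
  (ncl_proj (amalgam_relators i1 i2) \o @fp_inl G1 G2).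
HB.instance Definition _ := Multiplicative.copy amalgam_inr
  (ncl_proj (amalgam_relators i1 i2) \o @fp_inr G1 G2).

Lemma amalgam_glue h : amalgam_inl (i1 h) = amalgam_inr (i2 h).
Proof.
apply: divg1_eq; rewrite /amalgam_inl /amalgam_inr /= -multiplicativeV -gmulfM.
have [[N1 NF] _] := normal_closureP (amalgam_relators i1 i2).
rewrite -[RHS](@multiplicative1 _ _ (ncl_proj (amalgam_relators i1 i2))).
apply/esym/nclE; rewrite invg1 mul1g.
by move=> N [_]; apply; exists h.
Qed.

(** The existence half of the universal property: the map induced on the free product kills every
    relator because [a1] and [a2] agree on $H$. *)
Lemma amalgam_lift (K : groupType)
    (a1 : {multiplicative G1 -> K}) (a2 : {multiplicative G2 -> K}) :
    (forall h, a1 (i1 h) = a2 (i2 h)) ->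
  exists f : {multiplicative amalgam i1 i2 -> K},
    (forall x, f (amalgam_inl x) = a1 x) /\
    (forall y, f (amalgam_inr y) = a2 y).
Proof.
move=> a12; pose F : {multiplicative free_product G1 G2 -> K} := fp_lift a1 a2.
have FS x : amalgam_relators i1 i2 x -> F x = 1.
  move=> [h _ <-]; rewrite gmulfM multiplicativeV /F /=.
  by rewrite fp_lift_inl fp_lift_inr a12 mulgV.
pose m := isMultiplicative.Build _ K _ (ncl_liftM FS).
pose f : {multiplicative amalgam i1 i2 -> K} := HB.pack (ncl_lift F) m.
exists f; split=> x; apply: etrans (ncl_lift_proj FS _) _.
  exact: fp_lift_inl.
exact: fp_lift_inr.
Qed.

(** The factors generate the amalgam already as a monoid, since inverses of letters are letters; the
    empty word is the image of 1. *)
Lemma amalgam_ind (P : amalgam i1 i2 -> Prop) :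
    (forall x, P (amalgam_inl x)) -> (forall y, P (amalgam_inr y)) ->
    (forall a b, P a -> P b -> P (a * b)) ->
  forall a, P a.
Proof.
move=> P1 P2 PM a; rewrite -[a]ncl_reprK -[ncl_repr a]fp_reprK.
elim: (fp_repr _) => [|l w IHw].
  by have := P1 1; rewrite multiplicative1.
rewrite -cat1s fp_class_cat.
pose pi := ncl_proj (amalgam_relators i1 i2).
rewrite [ncl_proj _ _](@gmulfM _ _ pi (fp_class [:: l])).
by apply: PM => //; case: l => [x|y]; [exact: P1 | exact: P2].
Qed.

End AmalgamUniversal.

(** * The unitary part of an operator *)

Section Eigenbasis.
Variables (C : numClosedFieldType) (U : vectType C).
Variable form : {dot U for @Num.conj C}.
Local Notation "''[' u , v ]" := (form u%R v%R) : ring_scope.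
Local Notation "''[' u ]" := '[u, u] : ring_scope.

Lemma stable_eigenvector (S : 'End(U)) (W : {vspace U}) :
  (S @: W <= W)%VS -> W != 0%VS ->
  exists2 w, w \in W & w != 0 /\ exists a, S w = a *: w.
Proof.
move=> SW W0; pose b := vbasis W.
(* An index past the dimension yields the default 0, which also lies in [W]. *)
have bW i : b`_i \in W.
  have [lti|gei] := ltnP i (\dim W); last first.
    by rewrite nth_default ?size_tuple ?mem0v.
  by rewrite vbasis_mem // mem_nth ?size_tuple.
pose A := \matrix_(i < \dim W, j < \dim W) coord b j (S b`_i).
have [|a /eigenvalueP[v vA v0]] := eigenvalue_closed A.
  by rewrite lt0n dimv_eq0.
have Sb (i : 'I_(\dim W)) : S b`_i = \sum_j A i j *: b`_j.
  rewrite [LHS](coord_vbasis (subvP SW _ (memv_img S (bW i)))).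
  by apply: eq_bigr => j _; rewrite mxE.
exists (\sum_i v 0 i *: b`_i).
  by apply: rpred_sum => i _; apply: rpredZ.
split; last first.
  exists a; rewrite linear_sum.
  under eq_bigr do rewrite linearZ /= Sb scaler_sumr.
  rewrite exchange_big scaler_sumr /=; apply: eq_bigr => j _.
  move/rowP: vA => /(_ j); rewrite !mxE => vAj.
  rewrite scalerA -vAj scaler_suml; apply: eq_bigr => i _.
  by rewrite scalerA.
apply: contraNneq v0 => vb0; apply/eqP/rowP => i; rewrite mxE.
by have /freeP/(_ (v 0) vb0 i) := basis_free (vbasisP W).
Qed.

(** Spectral theorem. An orthonormal family of eigenvectors that does not span has a nonzero
    orthogonal complement; self-adjointness makes it stable under [S], so it contains a further
    eigenvector. The induction is on the size of the family, so that the ambient space never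
    changes. *)
Lemma selfadjoint_eigenbasis (S : 'End(U)) :
    (forall u v, '[S u, v] = '[u, S v]) ->
  exists e : seq U, [/\ orthonormal form e, basis_of {:U} e &
    {in e, forall v, exists a, S v = a *: v}].
Proof.
move=> Ssym.
suff /(_ _ (leqnn _))[e [se oe Se]] k : (k <= \dim {:U})%N ->
    exists e : seq U, [/\ size e = k, orthonormal form e &
      {in e, forall v, exists a, S v = a *: v}].
  exists e; split=> //.
  by rewrite basisEfree subvf se leqnn (orthonormal_free oe).
elim: k => [_|k IHk ltk]; first by exists [::]; split.
have [e [se oe Se]] := IHk (ltnW ltk).
have W0 : orthov form <<e>> != 0%VS.
  have /subvPn[v _ ve] : ~~ (fullv <= <<e>>)%VS.
    apply/negP => /dimvS; apply/negP; rewrite -ltnNge.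
    by rewrite (leq_ltn_trans (dim_span _)) // se.
  have [x xe [y [vxy xy oy]]] := orthogonal_split form e v.
  apply: contraNneq ve => We; rewrite vxy rpredD //.
  suff -> : y = 0 by exact: mem0v.
  apply/eqP; rewrite -memv0 -We; apply/mem_orthovP => z ze.
  by apply: (span_orthogonal oy) => //; rewrite memv_span ?mem_head.
have SW : (S @: orthov form <<e>> <= orthov form <<e>>)%VS.
  apply/subvP => _ /memv_imgP[w /mem_orthovP we ->].
  apply/mem_orthovP => z ze; apply: etrans (Ssym w z) (we _ _).
  rewrite (coord_span (X := in_tuple e) ze) linear_sum rpred_sum // => i _.
  rewrite linearZ rpredZ //=; have ie : e`_i \in e by rewrite mem_nth.
  by have [a ->] := Se _ ie; rewrite rpredZ ?memv_span.
have [w wW [w0 [a Sw]]] := stable_eigenvector SW W0.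
exists ((sqrtC '[w])^-1 *: w :: e); split.
- by rewrite /= se.
- rewrite -cat1s orthonormal_cat oe /= andbT; apply/andP; split.
    rewrite /orthonormal /= !andbT dnormZ normfV ger0_norm ?sqrt_dnorm_ge0 //.
    by rewrite exprVn sqrtCK mulVf // dnorm_eq0.
  rewrite /orthogonal /ortho_rec /=; apply/allP => z ze; apply/eqP.
  apply: etrans (linearZl_LR form _ _ _) _ => /=.
  by move/mem_orthovP: wW => /(_ z (memv_span ze)) /= ->; rewrite mulr0.
- move=> v; rewrite inE => /predU1P[->|/Se//].
  by exists a; rewrite linearZ /= Sw !scalerA mulrC.
Qed.

End Eigenbasis.

Section UnitaryPart.
Variables (C : numClosedFieldType) (U : vectType C).
Variable form : {dot U for @Num.conj C}.
Local Notation "''[' u , v ]" := (form u%R v%R) : ring_scope.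
Local Notation "''[' u ]" := '[u, u] : ring_scope.

Lemma dotC u v : '[u, v] = ('[v, u])^*.
Proof. by rewrite hermC /= expr0 mul1r. Qed.

Lemma dotZl a u v : '[a *: u, v] = a * '[u, v].
Proof. exact: linearZl_LR. Qed.

Lemma dotZr a u v : '[u, a *: v] = a^* * '[u, v].
Proof. exact: linearZr_LR. Qed.

Lemma dot_suml I (r : seq I) (P : pred I) (F : I -> U) v :
  '[\sum_(i <- r | P i) F i, v] = \sum_(i <- r | P i) '[F i, v].
Proof. exact: linear_sumlz. Qed.

Lemma dot_sumr I (r : seq I) (P : pred I) u (F : I -> U) :
  '[u, \sum_(i <- r | P i) F i] = \sum_(i <- r | P i) '[u, F i].
Proof. exact: linear_sumr. Qed.

Lemma dot_sum_orthonormal n (f : 'I_n -> U) (a b : 'I_n -> C) :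
    (forall i j, '[f i, f j] = (i == j)%:R) ->
  '[\sum_i a i *: f i, \sum_i b i *: f i] = \sum_i a i * (b i)^*.
Proof.
move=> of1; rewrite dot_suml; apply: eq_bigr => i _.
rewrite dot_sumr (bigD1 i) //= big1 ?addr0 => [|j /negPf ji].
  by rewrite dotZl dotZr of1 eqxx mulr1.
by rewrite dotZl dotZr of1 eq_sym ji !mulr0.
Qed.

(* T' is the adjoint of T and W its unitary factor. Intertwining passes from  *)
(* T to W because g preserves the eigenspaces of T' T, on each of which W is  *)
(* a multiple of T.                                                           *)
Lemma unitary_part (T T' : 'End(U)) (eps : C) :
    (forall u v, '[T u, v] = '[u, T' v]) -> 0 <= eps < 1 ->
    (forall v, sqrtC '[T v - v] <= eps * sqrtC '[v]) ->
  exists W : 'End(U), [/\ isometry form form W,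
    forall v, sqrtC '[W v - v] <= (eps + eps) * sqrtC '[v] &
    forall f g : 'End(U), (forall v, f (T v) = T (g v)) ->
      (forall v, T' (f v) = g (T' v)) -> forall v, f (W v) = W (g v)].
Proof.
move=> adjT /andP[eps0 eps1] T1.
have triangle u v : sqrtC '[u + v] <= sqrtC '[u] + sqrtC '[v].
  by case: (triangle_lerif form u v).
have normB u v : sqrtC '[u - v] = sqrtC '[v - u] by rewrite -opprB hnormN.
have adjT' u v : '[T' u, v] = '[u, T v] by rewrite dotC -adjT -dotC.
have [|e [oe be Te]] := @selfadjoint_eigenbasis _ _ form (T' \o T)%VF.
  by move=> u v; rewrite !comp_lfunE adjT' adjT.
have /orthonormalP[ue oee] := oe.
(* On the eigenbasis [e] of $T^*T$ these are the singular values of [T]. *)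
pose s v := sqrtC '[T v].
have eigT v : v \in e -> T' (T v) = s v ^+ 2 *: v.
  move=> ve; have [a] := Te v ve; rewrite comp_lfunE => TTv.
  rewrite TTv sqrtCK; congr (_ *: _).
  by rewrite -adjT' TTv dotZl oee // eqxx mulr1.
(* Reverse triangle inequality between [T v] and the unit vector [v]. *)
have s_eps v : v \in e -> `|s v - 1| <= eps.
  move=> ve; have nv : sqrtC '[v] = 1 by rewrite oee // eqxx sqrtC1.
  have := T1 v; rewrite nv mulr1 => Tv.
  have s_real : s v - 1 \is Num.real.
    by rewrite rpredB // ger0_real ?sqrt_dnorm_ge0.
  have s_ge : 1 <= eps + s v.
    apply: le_trans (lerD Tv (lexx (s v))).
    by have := triangle (v - T v) (T v); rewrite subrK nv normB.
  have s_le : s v <= eps + 1.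
    apply: le_trans (lerD Tv (lexx 1)).
    by have := triangle (T v - v) v; rewrite subrK nv.
  by rewrite real_ler_norml // lerBlDr s_le andbT lerNl opprB lerBlDr.
have s_gt0 v : v \in e -> 0 < s v.
  move=> ve; rewrite lt_def sqrt_dnorm_ge0 andbT.
  apply/eqP => sv; have := s_eps v ve; rewrite sv sub0r normrN1 => e1.
  by have := lt_le_trans eps1 e1; rewrite ltxx.
(* $T(T^*T)^{-1/2}$ on the eigenbasis; [eps < 1] has kept the singular values away from 0. *)
pose f v := (s v)^-1 *: T v.
have [W0 W0e] := linear_of_free e (map f e).
pose W : 'End(U) := linfun W0.
have We v : v \in e -> W v = f v.
  have : map W0 e = map f e by rewrite W0e ?size_map ?(basis_free be).
  by move=> /eq_in_map W0f ve; rewrite lfunE /= W0f.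
pose b := in_tuple e; pose x v i := coord b i v.
have bE (i : 'I_(size e)) : e`_i \in e by rewrite mem_nth.
have vE v : v = \sum_i x v i *: e`_i.
  by have /coord_basis := be : basis_of fullv b; apply; exact: memvf.
have bo (i j : 'I_(size e)) : '[e`_i, e`_j] = (i == j)%:R.
  by rewrite oee // nth_uniq.
have fo (i j : 'I_(size e)) : '[W e`_i, W e`_j] = (i == j)%:R.
  rewrite !We // /f dotZl dotZr adjT eigT // dotZr bo -(inj_eq val_inj) /=.
  have [<-|_] := eqVneq (i : nat) j; last by rewrite !mulr0.
  have si := s_gt0 _ (bE i); have si0 := lt0r_neq0 si.
  rewrite !conj_Creal ?rpredX ?rpredV ?gtr0_real // mulr1.
  by rewrite expr2 mulKf // mulVf.
have WE v : W v = \sum_i x v i *: W e`_i.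
  by rewrite {1}[v]vE linear_sum; apply: eq_bigr => i _; rewrite linearZ.
have TE v : T v = \sum_i (x v i * s e`_i) *: W e`_i.
  rewrite {1}[v]vE linear_sum; apply: eq_bigr => i _; rewrite linearZ /=.
  by rewrite We // /f scalerA mulfK // lt0r_neq0 // s_gt0.
exists W; split.
- move=> u v; rewrite -[LHS]/('[W u, W v]) -[RHS]/('[u, v]).
  rewrite !WE [u in RHS]vE [v in RHS]vE.
  by rewrite !dot_sum_orthonormal.
(* One [eps] pays for [T v - v], the other for [W v - T v], whose coordinates in the orthonormal
   family [W e_i] are those of [v] times [1 - s e_i]. *)
- move=> v; rewrite mulrDl -(subrKA (T v)) (le_trans (triangle _ _)) //.
  rewrite lerD // WE TE -sumrB.
  under eq_bigr do rewrite -scalerBl -[X in X - _]mulr1 -mulrBr.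
  have -> : '[v] = \sum_i x v i * (x v i)^*.
    by rewrite [in LHS](vE v) dot_sum_orthonormal.
  rewrite dot_sum_orthonormal //.
  rewrite -[eps in X in _ <= X](sqrCK eps0).
  rewrite -sqrtCM ?nnegrE ?exprn_ge0 //; last first.
    by apply: sumr_ge0 => i _; rewrite -normCK exprn_ge0.
  rewrite ler_sqrtC ?nnegrE; last 2 first.
  - by apply: sumr_ge0 => i _; rewrite -normCK exprn_ge0.
  - rewrite mulr_ge0 ?exprn_ge0 //.
    by apply: sumr_ge0 => i _; rewrite -normCK exprn_ge0.
  rewrite mulr_sumr ler_sum // => i _; rewrite -!normCK normrM exprMn mulrC.
  rewrite ler_wpM2r ?exprn_ge0 // lerXn2r ?nnegrE //.
  by rewrite distrC s_eps.
- move=> g h gT T'g v.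
  (* The vector [h e_i] stays in the eigenspace of $T^*T$ for [s e_i ^+ 2], so only those [e_j] with
     the same singular value occur in it, and there [T] is [s e_i] times [W]. *)
  have gh (i : 'I_(size e)) : g (W e`_i) = W (h e`_i).
    set u := h _; have Tu : T' (T u) = s e`_i ^+ 2 *: u.
      by rewrite -gT T'g eigT // linearZ.
    have xs j : x u j * s e`_j = x u j * s e`_i.
      have xE : x u j = '[u, e`_j].
        rewrite {2}[u]vE dot_suml (bigD1 j) //= big1 ?addr0 => [|k /negPf kj].
          by rewrite dotZl bo eqxx mulr1.
        by rewrite dotZl bo kj mulr0.
      have : '[T' (T u), e`_j] = '[u, T' (T e`_j)] by rewrite adjT' adjT.
      rewrite Tu eigT // dotZl dotZr -xE conj_Creal ?rpredX ?gtr0_real ?s_gt0 //.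
      rewrite ![_ * x u j]mulrC; have [->|x0] := eqVneq (x u j) 0.
        by rewrite !mul0r.
      move=> /(mulfI x0)/eqP; rewrite eqrXn2 ?ltW ?s_gt0 //.
      by move=> /eqP ->.
    rewrite We // linearZ /= gT TE; under eq_bigr do rewrite xs mulrC -scalerA.
    by rewrite -scaler_sumr -WE scalerA mulVf ?scale1r // lt0r_neq0 // s_gt0.
  rewrite WE linear_sum [v in RHS]vE !linear_sum; apply: eq_bigr => i _.
  by rewrite !linearZ /= gh.
Qed.

End UnitaryPart.

(** * Operator norm distance and intertwiners *)

Section UnitaryDistance.
Variables (R : realType) (X : fdHilbertType R).
Implicit Types (v w : X) (f g h : unitary X).

(** Passes between the real norm defining the operator norm and the complex-valued one in which the
    unitary part is estimated. *)
Lemma hnormE v : ((hnorm v)%:C)%C = sqrtC (hdot X v v).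
Proof.
have := dnorm_ge0 (hdot X) v; rewrite lecE /= => /andP[/eqP v_im v_re].
apply/eqP; rewrite -(@eqrXn2 _ 2) ?sqrt_dnorm_ge0 ?lecR ?sqrtr_ge0 //.
rewrite sqrtCK -rmorphXn sqr_sqrtr //=; apply/eqP.
by case: (hdot X v v) v_im => a b /= ->.
Qed.

Lemma hnorm_ge0 v : 0 <= hnorm v. Proof. exact: sqrtr_ge0. Qed.

Lemma hnorm0 : hnorm (0 : X) = 0.
Proof. by rewrite /hnorm linear0r sqrtr0. Qed.

Lemma hnorm_eq0 v : (hnorm v == 0) = (v == 0).
Proof. by rewrite -(fmorph_eq0 (real_complex R)) /= hnormE sqrt_dnorm_eq0. Qed.

Lemma hnormB v w : hnorm (v - w) = hnorm (w - v).
Proof. by rewrite /hnorm -opprB hnormN. Qed.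

Lemma ler_hnormD v w : hnorm (v + w) <= hnorm v + hnorm w.
Proof.
rewrite -lecR rmorphD /= !hnormE.
by case: (triangle_lerif (hdot X) v w).
Qed.

Lemma hnormZ (a : R) v : 0 <= a -> hnorm ((a%:C)%C *: v) = a * hnorm v.
Proof.
move=> a0; apply: (@complexI R); rewrite rmorphM /= !hnormE dnormZ.
have a0C : 0 <= (a%:C)%C :> R[i] by rewrite lecR.
by rewrite sqrtCM ?nnegrE ?exprn_ge0 ?dnorm_ge0 // ger0_norm // sqrCK.
Qed.

Lemma ler_hnorm_sum I (r : seq I) (P : pred I) (F : I -> X) :
  hnorm (\sum_(i <- r | P i) F i) <= \sum_(i <- r | P i) hnorm (F i).
Proof.
elim/big_rec2: _ => [|i a v _ va]; first by rewrite hnorm0.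
by rewrite (le_trans (ler_hnormD _ _)) // lerD2l.
Qed.

Lemma unitary_hnorm f v : hnorm (f v) = hnorm v.
Proof. by rewrite /hnorm unitaryP. Qed.

Lemma unitaryM f g v : (f * g)%g v = f (g v).
Proof. by rewrite -[LHS]/((f \o g)%VF v) comp_lfunE. Qed.

Lemma unitary1 v : (1%g : unitary X) v = v.
Proof. by rewrite -[LHS]/(\1%VF v) id_lfunE. Qed.

Lemma unitaryKV f v : f (f^-1%g v) = v.
Proof. by rewrite -unitaryM mulgV unitary1. Qed.

Lemma unitary_ext f g : (forall v, f v = g v) -> f = g.
Proof. by move=> fg; apply/val_inj/lfunP. Qed.

Lemma unitaryV f v w : hdot X (f v) w = hdot X v (f^-1%g w).
Proof. by rewrite -[RHS](unitaryP f) unitaryKV. Qed.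

Lemma hnormB_le2 f g v : hnorm (f v - g v) <= 2 * hnorm v.
Proof.
rewrite (le_trans (ler_hnormD _ _)) // /hnorm hnormN -!/(hnorm _).
by rewrite !unitary_hnorm mulrDl mul1r.
Qed.

Lemma unitary_dist_ler f g (c : R) : 0 <= c ->
  (forall v, hnorm (f v - g v) <= c * hnorm v) -> unitary_dist f g <= c.
Proof.
move=> c0 fgc; apply: sup_le_ub.
  by exists (hnorm (((f : 'End(X)) - (g : 'End(X))) 0)), 0 => //=; rewrite hnorm0.
move=> _ [v /= v1 <-]; rewrite add_lfunE opp_lfunE (le_trans (fgc v)) //.
by rewrite ler_piMr.
Qed.

(** With [unitary_dist_ler], this makes the distance the least admissible constant, so later
    estimates can avoid the supremum. *)
Lemma ler_unitary_dist f g v : hnorm (f v - g v) <= unitary_dist f g * hnorm v.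
Proof.
have [->|v0] := eqVneq v 0; first by rewrite !linear0 addr0 hnorm0 mulr0.
have nv_gt0 : 0 < hnorm v by rewrite lt_def hnorm_eq0 v0 hnorm_ge0.
rewrite -ler_pdivrMr // mulrC -hnormZ ?invr_ge0 ?hnorm_ge0 //.
rewrite scalerBr -!linearZ -opp_lfunE -add_lfunE; set w := _ *: v.
have w1 : hnorm w <= 1.
  by rewrite hnormZ ?invr_ge0 ?hnorm_ge0 // mulVf // lt0r_neq0.
apply: ub_le_sup; last by exists w.
(* The supremum dominates its set only once the set is known to be bounded; 2 is a bound. *)
exists 2 => _ [u /= u1 <-]; rewrite add_lfunE opp_lfunE.
by rewrite (le_trans (hnormB_le2 f g u)) // ler_piMr.
Qed.

Lemma unitary_dist_ge0 f g : 0 <= unitary_dist f g.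
Proof.
have [[v v0]|X0] := pselect (exists v : X, v != 0).
  have nv_gt0 : 0 < hnorm v by rewrite lt_def hnorm_eq0 v0 hnorm_ge0.
  rewrite -(pmulr_lge0 _ nv_gt0).
  by rewrite (le_trans _ (ler_unitary_dist f g v)) ?hnorm_ge0.
(* In dimension 0 the supremum is taken over the singleton 0. *)
rewrite /unitary_dist /opnorm (_ : [set _ | _ in _] = [set 0]) ?sup1 //.
apply/seteqP; split=> [_ [v _ <-]|_ ->]; last first.
  by exists 0; rewrite /= ?linear0 hnorm0.
suff -> : v = 0 by rewrite /= linear0 hnorm0.
by apply/eqP/negPn/negP => v0; apply: X0; exists v.
Qed.

Lemma unitary_dist_le2 f g : unitary_dist f g <= 2.
Proof. by apply: unitary_dist_ler => // v; exact: hnormB_le2. Qed.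

Lemma unitary_distC f g : unitary_dist f g = unitary_dist g f.
Proof.
by apply/le_anti/andP; split; apply: unitary_dist_ler => [|v];
  rewrite ?unitary_dist_ge0 // hnormB ler_unitary_dist.
Qed.

Lemma unitary_distxx f : unitary_dist f f = 0.
Proof.
apply/le_anti; rewrite unitary_dist_ge0 andbT unitary_dist_ler // => v.
by rewrite subrr hnorm0 mul0r.
Qed.

Lemma unitary_dist_triangle g f h :
  unitary_dist f h <= unitary_dist f g + unitary_dist g h.
Proof.
apply: unitary_dist_ler => [|v]; first by rewrite addr_ge0 ?unitary_dist_ge0.
rewrite -(subrKA (g v)) (le_trans (ler_hnormD _ _)) // mulrDl.
by rewrite lerD ?ler_unitary_dist.
Qed.

Lemma unitary_distM f f' g g' :
  unitary_dist (f * f')%g (g * g')%g <= unitary_dist f g + unitary_dist f' g'.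
Proof.
apply: unitary_dist_ler => [|v]; first by rewrite addr_ge0 ?unitary_dist_ge0.
rewrite !unitaryM -(subrKA (g (f' v))) (le_trans (ler_hnormD _ _)) // mulrDl.
rewrite -linearB unitary_hnorm lerD ?ler_unitary_dist //.
by rewrite -(unitary_hnorm f' v) ler_unitary_dist.
Qed.

Lemma unitary_distV f g : unitary_dist f^-1%g g^-1%g = unitary_dist f g.
Proof.
have dV f' g' : unitary_dist f'^-1%g g'^-1%g <= unitary_dist f' g'.
  apply: unitary_dist_ler => [|v]; first exact: unitary_dist_ge0.
  have -> : hnorm (f'^-1%g v - g'^-1%g v) =
      hnorm (f' (g'^-1%g v) - g' (g'^-1%g v)).
    rewrite unitaryKV hnormB -(unitary_hnorm f') linearB.
    by congr (hnorm (_ - _)); exact: unitaryKV.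
  by rewrite (le_trans (ler_unitary_dist _ _ _)) // unitary_hnorm.
by apply/le_anti; rewrite dV /=; have := dV f^-1%g g^-1%g; rewrite !invgK.
Qed.

End UnitaryDistance.

Lemma unitary_intertwiner (R : realType) (X : fdHilbertType R) (H : finGroupType)
    (r1 r2 : {multiplicative H -> unitary X}) :
    \sum_h unitary_dist (r1 h) (r2 h) < 1 ->
  exists u : unitary X, (forall h, r1 h * u = u * r2 h)%g /\
    unitary_dist u 1%g <= 2 * \sum_h unitary_dist (r1 h) (r2 h).
Proof.
set eps := \sum_h _ => eps1.
have eps0 : 0 <= eps by apply: sumr_ge0 => h _; exact: unitary_dist_ge0.
pose k : R := #|H|%:R^-1.
have cardH0 : #|H|%:R != 0 :> R by rewrite pnatr_eq0 -lt0n -cardsT cardG_gt0.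
have k0 : 0 <= k by rewrite invr_ge0 ler0n.
pose avg (r r' : {multiplicative H -> unitary X}) : 'End(X) :=
  (k%:C)%C *: \sum_h unitary_val (r h * r' h^-1)%g.
have avgE (r r' : {multiplicative H -> unitary X}) v :
    avg r r' v = (k%:C)%C *: \sum_h r h (r' h^-1%g v).
  rewrite scale_lfunE sum_lfunE; congr (_ *: _).
  by apply: eq_bigr => h _; rewrite unitaryM.
(* Reindexing the average by left translation. Stated for both orders of the representations,
   because exchanging them gives the adjoint and [unitary_part] needs both relations. *)
have avgJ (r r' : {multiplicative H -> unitary X}) h v :
    r h (avg r r' v) = avg r r' (r' h v).
  rewrite !avgE linearZ linear_sum /=; congr (_ *: _).
  rewrite [RHS](reindex_inj (mulgI h)); apply: eq_bigr => g _ /=.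
  rewrite -!unitaryM invgM !gmulfM !mulgA; congr (unitary_val _ _).
  by rewrite !multiplicativeV mulgVK.
have avg_adj u v : hdot X (avg r1 r2 u) v = hdot X u (avg r2 r1 v).
  rewrite !avgE dotZl dotZr dot_suml dot_sumr.
  congr (_ * _); first by rewrite conj_Creal // ger0_real // lecR.
  by apply: eq_bigr => h _; rewrite !unitaryV -!multiplicativeV invgK.
have avg_near v : hnorm (avg r1 r2 v - v) <= eps * hnorm v.
  have -> : avg r1 r2 v - v = (k%:C)%C *: \sum_h (r1 h (r2 h^-1%g v) - v).
    rewrite avgE sumrB scalerBr sumr_const -scaler_nat scalerA.
    by rewrite -(rmorph_nat (real_complex R)) -rmorphM mulVf // scale1r.
  rewrite hnormZ // (le_trans (ler_wpM2l k0 (ler_hnorm_sum _ _ _))) //.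
  have -> : eps * hnorm v = k * \sum_(h : H) eps * hnorm v.
    by rewrite sumr_const -mulr_natl mulrA mulVf // mul1r.
  (* Writing [v] as [r2 h] applied to $r_2(h)^{-1}v$ bounds each term by the distance of [r1 h] and
     [r2 h], one summand of [eps]. *)
  rewrite ler_wpM2l // ler_sum // => h _; rewrite -[v in _ - v](unitaryKV (r2 h)).
  rewrite -multiplicativeV (le_trans (ler_unitary_dist _ _ _)) // unitary_hnorm.
  rewrite ler_wpM2r ?hnorm_ge0 // /eps (bigD1 h) //= lerDl.
  by apply: sumr_ge0 => g _; exact: unitary_dist_ge0.
have [|v|W [isoW W1 Wcomm]] := @unitary_part _ _ (hdot X) _ _ (eps%:C)%C avg_adj.
- by rewrite lecR ltcR eps0.
- by rewrite -!hnormE -rmorphM lecR.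
have Wu : unitary_pred W by apply/asboolP.
exists (Unitary Wu); split=> [h|].
  apply: unitary_ext => v; rewrite !unitaryM /=.
  by apply: Wcomm => w; rewrite avgJ.
apply: unitary_dist_ler => [|v]; first by rewrite mulr_ge0.
rewrite unitary1 -lecR rmorphM /= !hnormE.
by rewrite (_ : (2 * eps)%:C%C = eps%:C%C + eps%:C%C) ?W1 // -rmorphD mulr_natl.
Qed.

(** * Stability of amalgams *)

Lemma le_cvg0 (R : realType) (u v : R^nat) :
  (forall n, 0 <= u n <= v n) -> v @ \oo --> 0 -> u @ \oo --> 0.
Proof.
move=> uv v0; apply: squeeze_cvgr (cvg_cst 0) v0.
by near=> n; exact: uv.
Unshelve. all: by end_near. Qed.

(** Conjugation by [u] moves a unitary by at most twice the distance from [u] to 1, itself at most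
    [2 * eps]; hence the 4. No smallness of [eps] is assumed, so the lemma applies to every term of
    a sequence. *)
Lemma amalgam_unitary_lift (R : realType) (X : fdHilbertType R)
    (H : finGroupType) (G1 G2 : groupType)
    (i1 : {multiplicative H -> G1}) (i2 : {multiplicative H -> G2})
    (r1 : {multiplicative G1 -> unitary X})
    (r2 : {multiplicative G2 -> unitary X}) :
  let eps := \sum_h unitary_dist (r1 (i1 h)) (r2 (i2 h)) in
  exists r : {multiplicative amalgam i1 i2 -> unitary X},
    (forall x, unitary_dist (r1 x) (r (amalgam_inl i1 i2 x)) <= 4 * eps) /\
    (forall y, unitary_dist (r2 y) (r (amalgam_inr i1 i2 y)) <= 4 * eps).
Proof.
move=> eps; have eps0 : 0 <= eps.
  by apply: sumr_ge0 => h _; exact: unitary_dist_ge0.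
have [eps1|eps1] := ltP eps 1; last first.
  (* Any two unitaries are at distance at most 2 <= 4 * eps. *)
  exists (one_fun (unitary X)); split=> x;
    by rewrite (le_trans (unitary_dist_le2 _ _)) //; lra.
have [u [ru u1]] := @unitary_intertwiner _ _ _ (r1 \o i1) (r2 \o i2) eps1.
pose r2u (y : G2) := (u * r2 y * u^-1)%g.
have r2uM : {morph r2u : x y / (x * y)%g}.
  by move=> x y; rewrite /r2u gmulfM !mulgA mulgVK.
pose r2um := isMultiplicative.Build _ _ r2u r2uM.
pose r2' : {multiplicative G2 -> unitary X} := HB.pack r2u r2um.
have r12 h : r1 (i1 h) = r2' (i2 h).
  by rewrite /= /r2u -[(u * _)%g]ru mulgK.
have [r [rl rr]] := amalgam_lift r12.
exists r; split=> x; rewrite ?rl ?unitary_distxx ?mulr_ge0 // rr /= /r2u.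
(* Compare [1 * (r2 x * 1)] with [u * (r2 x * u^-1)] factor by factor. *)
rewrite -{1}[r2 x]mul1g -{1}[r2 x]mulg1 -mulgA.
apply: le_trans (unitary_distM _ _ _ _) _.
have := unitary_distM (r2 x) 1%g (r2 x) u^-1%g.
rewrite unitary_distxx add0r -{2}[1%g]invg1 unitary_distV => r2u1.
apply: le_trans (lerD (lexx _) r2u1) _.
by rewrite unitary_distC; move: u1; rewrite -/eps; lra.
Qed.

Theorem theorem1 (R : realType) (H : finGroupType) (G1 G2 : groupType)
  (i1 : {multiplicative H -> G1}) (i2 : {multiplicative H -> G2}) :
  injective i1 -> injective i2 ->
  finitely_generated G1 -> op_norm_stable R G1 ->
  finitely_generated G2 -> op_norm_stable R G2 ->
  op_norm_stable R (amalgam i1 i2).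
Proof.
move=> _ _ _ stable1 _ stable2 X phi phiM.
have [x y|psi1 psi1P] := stable1 X (fun n => phi n \o amalgam_inl i1 i2).
  by under eq_fun do rewrite /= gmulfM; exact: phiM.
have [x y|psi2 psi2P] := stable2 X (fun n => phi n \o amalgam_inr i1 i2).
  by under eq_fun do rewrite /= gmulfM; exact: phiM.
pose eps n := \sum_h unitary_dist (psi1 n (i1 h)) (psi2 n (i2 h)).
have eps0 : eps @ \oo --> 0.
  have -> : 0 = \sum_(h : H) (0 : R) by rewrite big1.
  apply: cvg_big => [|h _]; first exact: add_continuous.
  apply: (@le_cvg0 _ _ (fun n =>
    unitary_dist (phi n (amalgam_inl i1 i2 (i1 h))) (psi1 n (i1 h)) +
    unitary_dist (phi n (amalgam_inr i1 i2 (i2 h))) (psi2 n (i2 h)))) => [n|].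
    (* Both copies of [h] have the same image in the amalgam, so [phi n] at that image is close to
       both [psi1] and [psi2]. *)
    rewrite unitary_dist_ge0 -amalgam_glue (unitary_distC _ (psi1 n _)).
    exact: unitary_dist_triangle.
  by rewrite -[0]addr0; apply: cvgD; [exact: psi1P | exact: psi2P].
have lift n := amalgam_unitary_lift i1 i2 (psi1 n) (psi2 n).
pose psi n := sval (cid (lift n)).
exists psi; apply: amalgam_ind => [x|y|a b phia phib].
- apply: (@le_cvg0 _ _ (fun n =>
    unitary_dist (phi n (amalgam_inl i1 i2 x)) (psi1 n x) + 4 * eps n)) => [n|].
    rewrite unitary_dist_ge0 /psi; case: cid => r [r1 r2] /=.
    by rewrite (le_trans (unitary_dist_triangle (psi1 n x) _ _)) // lerD2l.
  rewrite -[0]addr0 -[X in _ + X](mulr0 4).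
  by apply: cvgD; [exact: psi1P | exact: cvgMl_tmp].
- apply: (@le_cvg0 _ _ (fun n =>
    unitary_dist (phi n (amalgam_inr i1 i2 y)) (psi2 n y) + 4 * eps n)) => [n|].
    rewrite unitary_dist_ge0 /psi; case: cid => r [r1 r2] /=.
    by rewrite (le_trans (unitary_dist_triangle (psi2 n y) _ _)) // lerD2l.
  rewrite -[0]addr0 -[X in _ + X](mulr0 4).
  by apply: cvgD; [exact: psi2P | exact: cvgMl_tmp].
(* Since [psi n] is exactly multiplicative, the error at a product is at most the multiplicativity
   defect of [phi n] plus the errors at the two factors. *)
- apply: (@le_cvg0 _ _ (fun n =>
    unitary_dist (phi n a * phi n b)%g (phi n (a * b)%g) +
    (unitary_dist (phi n a) (psi n a) + unitary_dist (phi n b) (psi n b)))) => [n|].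
    rewrite unitary_dist_ge0 gmulfM.
    apply: le_trans (unitary_dist_triangle (phi n a * phi n b)%g _ _) _.
    by rewrite unitary_distC lerD2l unitary_distM.
  rewrite -[0]addr0 -[X in _ + X]addr0.
  by apply: cvgD; [exact: phiM | exact: cvgD].
Qed.
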